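(* Let $S\subseteq \mathcal S_n$ be a nicely separated subset. Then the Cayley graph $\Gamma(\mathcal S_n,S)$ is integral, i.e. all its eigenvalues are integers.
   Context: $\mathcal S_n$ denotes the symmetric group on $[n]=\{1,\dots,n\}$. For $\alpha\in\mathcal S_n$ put $\mathrm{Move}(\alpha)=\{i\in[n]\mid \alpha(i)\ne i\}$, and for $T\subseteq[n]$ put $\mathcal S_n(T)=\{\alpha\in\mathcal S_n\mid \mathrm{Move}(\alpha)\subseteq T\}$, the subgroup of permutations fixing every element of $[n]\setminus T$. For a partition $T_1,\dots,T_l$ of $[n]$ (that is, $[n]=\bigcup_{i=1}^l T_i$ and $T_i\cap T_j=\emptyset$ for $i\neq j$), put $\mathcal T(T_1,\dots,T_l)=\mathcal S_n\setminus\bigcup_{i=1}^l\mathcal S_n(T_i)$. For $s\in\mathcal S_n$, $\mathrm{Con}_{\mathcal S_n}(s)=\{g^{-1}sg\mid g\in\mathcal S_n\}$ is the conjugacy class of $s$. A subset $S$ of $\mathcal S_n$ is called nicely separated if there exists a partition $T_1,\dots,T_l$ of $[n]$ with $l\ge 2$ such that $S=\bigcup_{s\in S}\bigl(\mathrm{Con}_{\mathcal S_n}(s)\cap\mathcal T(T_1,\dots,T_l)\bigr)$. For a finite group $G$ and an inverse closed subset $S\subseteq G$, the Cayley graph $\Gamma(G,S)$ has vertex set $G$, with $u,v\in G$ adjacent if and only if $v=su$ for some $s\in S$. The eigenvalues of a graph are those of its adjacency matrix. *)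

(* Defs.v *)
From HB Require Import structures.
From mathcomp Require Import all_boot all_order all_algebra all_fingroup all_field.

Set Implicit Arguments.
Unset Strict Implicit.
Unset Printing Implicit Defensive.

Import Order.TTheory GRing.Theory Num.Theory GroupScope.

Section SeparatedPermutations.

Variable n : nat.

Definition Move (a : 'S_n) : {set 'I_n} := [set i | a i != i].

Definition perms_in (T : {set 'I_n}) : {set 'S_n} := [set a | Move a \subset T].

(* Blocks are indexed and are allowed to be empty, so this is weaker than
   [finset.partition]. *)
Definition partition_family (l : nat) (T : 'I_l -> {set 'I_n}) : Prop :=
  \bigcup_(i < l) T i = [set: 'I_n] /\
  (forall i j : 'I_l, i != j -> T i :&: T j = set0).

Definition transversing (l : nat) (T : 'I_l -> {set 'I_n}) : {set 'S_n} :=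
  [set: 'S_n] :\: \bigcup_(i < l) perms_in (T i).

(* [s ^: [set: 'S_n]] is the conjugacy class of [s]. *)
Definition nicely_separated (S : {set 'S_n}) : Prop :=
  exists (l : nat) (T : 'I_l -> {set 'I_n}),
    [/\ (2 <= l)%N,
        partition_family T
      & S = \bigcup_(s in S) ((s ^: [set: 'S_n]) :&: transversing T)].

End SeparatedPermutations.

(* Symmetric when [S] is inverse closed.  This holds for every nicely separated
   [S], since a permutation and its inverse are conjugate and move the same
   points. *)
Definition cayley (gT : finGroupType) (S : {set gT}) : rel gT :=
  fun u v => [exists s in S, v == s * u].

Definition adjacency_mx (V : finType) (e : rel V) : 'M[algC]_#|V| :=
  \matrix_(i, j) ((e (enum_val i) (enum_val j))%:R)%R.

(* Adjacency matrices have integer entries, so all their complex eigenvalues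
   lie in [algC]. *)
Definition integral_graph (V : finType) (e : rel V) : Prop :=
  forall a : algC, eigenvalue (adjacency_mx e) a -> a \in Num.int.

(* Main.v *)
Require Import Defs.
From mathcomp Require Import all_boot all_order all_algebra all_fingroup all_field.
From mathcomp Require Import all_character.

(** Let N be the union of the conjugacy classes that meet S.  Nice separation says that S is N with the pieces N_i, the intersections
of N with the subgroups Sym (T i), removed.  Two of these subgroups meet only in
the identity, which is not in N, so the pieces are disjoint and
  adjacency (S) = adjacency (N) - \sum_i adjacency (N_i).
All the matrices on the right commute: N is normalised by everything, and
permutations with disjoint supports commute.  Over the algebraic numbers,
commuting matrices have common eigenvectors, so each eigenvalue on the left is
an integer combination of eigenvalues of the matrices on the right
([integral_spectrum_sub_sum]), and it is enough to treat these one by one.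

Each of them is the Cayley matrix of a subset K of a group G that G normalises
and that contains, with x, every generator of the cyclic group of x.  For N this
closure property holds because two permutations that generate the same cyclic
group are conjugate ([perm_same_cycle_conj]); for N_i it follows by
intersecting with a subgroup.  Such a Cayley matrix has integer eigenvalues
([cayley_integral]).  An eigenvalue a is an algebraic integer, since the matrix
has integer entries.  It is also rational: the matrix is the action of the sum
of K in the representation of G by translations, the eigenspace W of a is a
subrepresentation because K is normalised by G, and the trace on W gives
  a * dim W = \sum_(k in K) chi_W k.
The right-hand side is an integer: for a cyclic group C the sum of chi_W over C
is #|C| times the multiplicity of the trivial character, so by induction on the
order of C the sum over the generators of C is an integer as well; and K is a
disjoint union of such sets of generators. *)

Set Implicit Arguments.
Unset Strict Implicit.
Unset Printing Implicit Defensive.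

Import Order.TTheory GRing.Theory Num.Theory.

Local Open Scope ring_scope.

(** * Character sums over generators of cyclic groups *)

(** Equivalently, [K] is stable under powers with exponent prime to the order,
the condition that makes sums of characters over [K] rational. *)
Definition generator_closed (gT : finGroupType) (K : {set gT}) : Prop :=
  forall x y, x \in K -> <[x]>%g = <[y]>%g -> y \in K.

(** The sum is the order of the cyclic group times the multiplicity of the
trivial character in the restriction of [chi] to it. *)
Lemma sum_char_cycle_int (gT : finGroupType) (G : {group gT}) (chi : 'CF(G))
    (x : gT) :
  chi \is a character -> x \in G -> \sum_(y in <[x]>%g) chi y \in Num.int.
Proof.
move=> chi_char Gx; have sxG : <[x]>%g \subset G by rewrite cycle_subG.
have h := Cnat_cfdot_char (cfRes_char <[x]>%G chi_char) (cfun1_char <[x]>%G).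
have -> : \sum_(y in <[x]>%g) chi y
        = #|<[x]>%g|%:R * '['Res[<[x]>%G] chi, 1].
  rewrite cfdotE mulrA divff ?mul1r ?pnatr_eq0 -?lt0n ?cardG_gt0 //.
  by apply: eq_bigr => y xy; rewrite cfResE // cfun1E xy rmorph1 mulr1.
by rewrite rpredM ?rpred_nat // intr_nat.
Qed.

(** Every element of [<[x]>] other than its generators generates a cyclic group
of smaller order, so induction on the order subtracts those contributions from
the sum over the whole of [<[x]>]. *)
Lemma sum_char_generators_int (gT : finGroupType) (G : {group gT})
    (chi : 'CF(G)) (x : gT) :
  chi \is a character -> x \in G ->
  \sum_(y | <[y]>%g == <[x]>%g) chi y \in Num.int.
Proof.
move=> chi_char; have [m] := ubnP #[x]%g; elim: m x => // m IHm x lexm Gx.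
have := sum_char_cycle_int chi_char Gx.
rewrite (partition_big (fun y => <[y]>%g) (fun H => H \subset <[x]>%g)) /=;
  last by move=> y; rewrite cycle_subG.
rewrite (bigD1 <[x]>%g) //=.
rewrite (eq_bigl (fun y => <[y]>%g == <[x]>%g)); last first.
  by move=> y; apply: andb_idl => /eqP <-; exact: cycle_id.
rewrite rpredDr //; apply: rpred_sum => H /andP[sHx neHx].
(* The elements of [<[x]>] that generate [H], if any, are all the generators of
   [H] in the group, since [H] lies inside [<[x]>]. *)
have [y /andP[xy /eqP eyH] | no_gen] := pickP [pred y in <[x]>%g | <[y]>%g == H].
  rewrite (eq_bigl (fun z => <[z]>%g == <[y]>%g)); last first.
    move=> z; rewrite eyH; apply: andb_idl => /eqP ezH.
    by rewrite (subsetP sHx) // -ezH cycle_id.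
  apply: IHm; last by rewrite (subsetP _ _ xy) // cycle_subG.
  rewrite -ltnS (leq_trans _ lexm) // ltnS.
  by rewrite proper_card // properEneq eyH neHx.
by rewrite (big_pred0 _ _ _ _ no_gen) rpred0.
Qed.

Lemma sum_char_generator_closed_int (gT : finGroupType) (G : {group gT})
    (chi : 'CF(G)) (K : {set gT}) :
  chi \is a character -> K \subset G -> generator_closed K ->
  \sum_(y in K) chi y \in Num.int.
Proof.
move=> chi_char sKG closedK.
rewrite (partition_big (fun y => <[y]>%g) predT) //=.
apply: rpred_sum => H _.
have [y /andP[Ky /eqP eyH] | no_gen] := pickP [pred y in K | <[y]>%g == H].
  rewrite (eq_bigl (fun z => <[z]>%g == <[y]>%g)); last first.
    move=> z; rewrite eyH; apply: andb_idl => /eqP ezH.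
    by rewrite (closedK y) // ezH.
  exact: (sum_char_generators_int chi_char (subsetP sKG _ Ky)).
by rewrite (big_pred0 _ _ _ _ no_gen) rpred0.
Qed.

(** * Eigenvalues of sums over normalised subsets *)

(** The eigenspace is a submodule on which the sum acts as the scalar [a], so
the trace expresses [a] as an integral character sum divided by the
dimension. *)
Lemma eigenvalue_repr_sum_rat (gT : finGroupType) (G : {group gT}) (d : nat)
    (rG : mx_representation algC G d) (K : {set gT}) (a : algC) :
  K \subset G -> G \subset 'N(K)%g -> generator_closed K ->
  eigenvalue (\sum_(k in K) rG k) a -> a \in Crat.
Proof.
move=> sKG nKG closedK; set M := \sum_(k in K) rG k => eig_a.
set W := eigenspace M a.
have Wmod : mxmodule rG W.
  apply/mxmoduleP => x Gx; apply: comm_mx_stable_eigenspace.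
  rewrite /comm_mx /M mulmx_suml mulmx_sumr.
  rewrite [RHS](reindex_inj (conjg_inj x)) /=; apply: eq_big => k.
    by rewrite memJ_norm // (subsetP nKG).
  move=> Kk; have Gk := subsetP sKG _ Kk.
  by rewrite -!repr_mxM ?groupJ // conjgE !mulgA mulgV mul1g.
set rW := submod_repr Wmod.
have sum_rW : \sum_(k in K) rW k = a%:M.
  rewrite -[LHS](raddf_sum (in_submod W)) -mulmx_sumr -/M.
  rewrite (eigenspaceP (val_submodP _)) -[LHS]/(in_submod W (a *: _)).
  by rewrite linearZ /= val_submodK scalemx1.
have := sum_char_generator_closed_int (cfRepr_char rW) sKG closedK.
rewrite (eq_bigr (fun k => \tr (rW k))); last first.
  by move=> k Kk; rewrite cfunE (subsetP sKG) // mulr1n.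
rewrite -raddf_sum /= sum_rW mxtrace_scalar -mulr_natr => int_tr.
have rk0 : (\rank W)%:R != 0 :> algC by rewrite pnatr_eq0 mxrank_eq0.
rewrite -(mulfK rk0 a) rpred_div ?rpred_nat //.
by rewrite rpred_int_num.
Qed.

Lemma eigenvalue_Aint (d : nat) (A : 'M[algC]_d) (a : algC) :
  (forall i j, A i j \in Num.int) -> eigenvalue A a -> a \in Aint.
Proof.
move=> intA; rewrite eigenvalue_root_char => root_a.
apply: root_monic_Aint root_a (char_poly_monic A) _.
(* The characteristic polynomial is the image of one over the integers. *)
have -> : A = map_mx intr (map_mx Num.floor A).
  by apply/matrixP => i j; rewrite !mxE floorK.
rewrite -map_char_poly; apply/polyOverP => i; rewrite coef_map.
exact: intr_int.
Qed.

(** * Cayley graphs of normalised, generator-closed subsets *)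

(** Matrices act on row vectors from the right, so these left translations
compose in the reversed order. *)
Definition translation_mx (gT : finGroupType) (x : gT) : 'M[algC]_#|gT| :=
  \matrix_(i, j) (enum_val j == x * enum_val i)%g%:R.

Lemma translation_mxM (gT : finGroupType) (x y : gT) :
  translation_mx x *m translation_mx y = translation_mx (y * x)%g.
Proof.
apply/matrixP => i j; rewrite !mxE (bigD1 (enum_rank (x * enum_val i)%g)) //=.
rewrite !mxE enum_rankK eqxx mul1r mulgA big1 ?addr0 // => k neq_k.
rewrite !mxE (_ : _ == _ = false) ?mul0r //; apply: contraNF neq_k => /eqP <-.
by rewrite enum_valK.
Qed.

(** The inverse turns the product-reversing translations into a
homomorphism. *)
Lemma translation_mx_repr (gT : finGroupType) (G : {group gT}) :
  mx_repr G (fun x : gT => translation_mx x^-1).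
Proof.
split=> [|x y _ _]; last by rewrite translation_mxM invMg.
apply/matrixP => i j; rewrite !mxE invg1 mul1g (inj_eq enum_val_inj).
by rewrite eq_sym.
Qed.

Lemma adjacency_cayley (gT : finGroupType) (K : {set gT}) :
  adjacency_mx (cayley K) = \sum_(k in K) translation_mx k.
Proof.
apply/matrixP => i j; rewrite mxE summxE /cayley.
set u := enum_val i; set v := enum_val j.
have uvE k : (v == k * u)%g = (k == v * u^-1)%g.
  by rewrite eq_sym -(can_eq (mulgK u^-1%g)) mulgK.
under eq_bigr do rewrite mxE uvE.
have [/existsP[k /andP[Kk]] | ] := boolP [exists k in K, v == k * u]%g.
  rewrite uvE => /eqP kE; rewrite (bigD1 k) //= kE eqxx big1 ?addr0 // => l.
  by rewrite -kE => /andP[_ /negPf->].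
rewrite negb_exists_in => /forall_inP no_k.
by rewrite big1 // => k /no_k; rewrite uvE => /negPf->.
Qed.

Definition integral_spectrum d (A : 'M[algC]_d) : Prop :=
  forall a, eigenvalue A a -> a \in Num.int.

(** An algebraic integer that is rational is an integer: rationality comes from
[eigenvalue_repr_sum_rat], algebraic integrality from the 0/1 entries. *)
Lemma cayley_integral (gT : finGroupType) (G : {group gT}) (K : {set gT}) :
  K \subset G -> G \subset 'N(K)%g -> generator_closed K ->
  integral_spectrum (adjacency_mx (cayley K)).
Proof.
move=> sKG nKG closedK a eig_a.
apply: Cint_rat_Aint; last first.
  by apply: eigenvalue_Aint eig_a => i j; rewrite mxE rpred_nat.
(* The representation uses inverses, which only permute the elements of [K],
   as [x] and its inverse generate the same subgroup. *)
have Kinv x : (x^-1 \in K)%g = (x \in K).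
  by apply/idP/idP => Kx; apply: (closedK _ _ Kx); rewrite cycleV.
pose rG := MxRepresentation (translation_mx_repr G).
apply: (@eigenvalue_repr_sum_rat _ G _ rG K) => //.
rewrite adjacency_cayley (reindex_inj invg_inj) in eig_a.
by rewrite /= -(eq_bigl _ _ Kinv).
Qed.

(** Conjugation by an element of [L] permutes [K], so that element commutes with
the sum of [K]. *)
Lemma comm_adjacency_cayley (gT : finGroupType) (K L : {set gT}) :
  L \subset 'N(K)%g ->
  comm_mx (adjacency_mx (cayley K)) (adjacency_mx (cayley L)).
Proof.
move=> nKL; rewrite !adjacency_cayley.
apply: comm_mx_sum => l Ll; rewrite /comm_mx mulmx_suml mulmx_sumr.
rewrite (reindex_inj (conjg_inj l)) /=; apply: eq_big => k.
  by rewrite memJ_norm // (subsetP nKL).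
by move=> _; rewrite !translation_mxM conjgE !mulgA mulgV mul1g.
Qed.

(** * Spectra of commuting matrices *)

(** An eigenspace of [A - B] is stable under [B], hence contains an eigenvector
of [B], which is then also an eigenvector of [A]. *)
Lemma integral_spectrumB d (A B : 'M[algC]_d) :
  comm_mx A B -> integral_spectrum A -> integral_spectrum B ->
  integral_spectrum (A - B).
Proof.
move=> cAB intA intB a; rewrite /eigenvalue => nzW.
set W := eigenspace (A - B) a in nzW.
have stW : stablemx W B.
  apply: comm_mx_stable_eigenspace; apply: comm_mx_sym.
  by apply: comm_mxB => //; exact: comm_mx_sym.
have [|b /eigenvalueP[v vB nzv]] := eigenvalue_closed (restrictmx W B).
  by rewrite lt0n mxrank_eq0.
have nzw : v *m row_base W != 0.
  by rewrite mulmx_free_eq0 ?row_base_free.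
have wB : v *m row_base W *m B = b *: (v *m row_base W).
  have /(congr1 (mulmx^~ (row_base W))) := vB.
  rewrite /= /conjmx (mulmxA v) (mulmxA v) -scalemxAl mulmxKpV //.
  by rewrite -[_ *m B]mulmxA mulmx_sub ?stablemx_row_base.
have wAB : v *m row_base W *m (A - B) = a *: (v *m row_base W).
  by apply/eigenspaceP; rewrite mulmx_sub ?eq_row_base.
have wA : v *m row_base W *m A = (a + b) *: (v *m row_base W).
  by rewrite scalerDl -wAB -wB mulmxBr subrK.
have int_b : b \in Num.int.
  by apply: intB; apply/eigenvalueP; exists (v *m row_base W).
suff: a + b \in Num.int by rewrite rpredDr.
by apply: intA; apply/eigenvalueP; exists (v *m row_base W).
Qed.

Lemma integral_spectrum_sub_sum d (I : eqType) (r : seq I) (A : 'M[algC]_d)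
    (B : I -> 'M[algC]_d) :
  integral_spectrum A -> (forall i, integral_spectrum (B i)) ->
  (forall i, comm_mx A (B i)) -> (forall i j, comm_mx (B i) (B j)) ->
  integral_spectrum (A - \sum_(i <- r) B i).
Proof.
move=> intA intB cAB cBB; elim: r => [|i r IHr]; first by rewrite big_nil subr0.
rewrite big_cons opprD addrCA addrC; apply: integral_spectrumB => //.
apply/comm_mx_sym/comm_mxB; first exact: comm_mx_sym.
exact: comm_mx_sum.
Qed.

(** * Permutations generating the same cyclic group *)

(** The coincidence says that [t ^ m * t ^- k] fixes [x]; so then does its power
[s ^ m * s ^- k]. *)
Lemma eq_iter_same_cycle (T : finType) (s t : {perm T}) (x : T) (m k : nat) :
  s \in <[t]>%g -> (t ^+ m)%g x = (t ^+ k)%g x -> (s ^+ m)%g x = (s ^+ k)%g x.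
Proof.
move=> /cycleP[j ->] tmk.
set u := (t ^+ m * (t ^+ k)^-1)%g.
have ux : u x = x by rewrite permM tmk permK.
have ujx : (u ^+ j)%g x = x by rewrite permX iter_fix.
have sE : ((t ^+ j) ^+ m = u ^+ j * (t ^+ j) ^+ k)%g.
  rewrite expgMn; last first.
    by apply: commuteV; apply: commuteX; apply: commute_sym; apply: commuteX.
  by rewrite expgVn -!expgM mulnC (mulnC j k) mulgKV.
by rewrite sE permM ujx.
Qed.

(** The permutations [s] and [t] have the same orbits.  On an orbit with base
point [r], mapping the [i]-th iterate of [r] under [s] to its [i]-th iterate
under [t] is a well-defined bijection that intertwines [s] with [t]. *)
Lemma perm_same_cycle_conj (T : finType) (s t : {perm T}) :
  <[s]>%g = <[t]>%g -> t \in (s ^: [set: {perm T}])%g.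
Proof.
move=> eq_st.
have s_t : s \in <[t]>%g by rewrite -eq_st cycle_id.
have t_s : t \in <[s]>%g by rewrite eq_st cycle_id.
have s_sym := fconnect_sym (@perm_inj _ s).
pose r x := froot s x; pose e x := findex s (r x) x.
have e_spec x : (s ^+ e x)%g (r x) = x.
  by rewrite permX iter_findex // s_sym connect_root.
have r_cycle u x : u \in <[s]>%g -> r (u x) = r x.
  case/cycleP=> j ->; rewrite permX; apply/esym/eqP.
  by rewrite /r (root_connect s_sym) fconnect_iter.
pose g x := (t ^+ e x)%g (r x).
have r_g x : r (g x) = r x.
  by rewrite r_cycle ?groupX // /r (root_root s_sym).
have g_inj : injective g.
  move=> x y gxy; have eq_r : r x = r y.
    by rewrite -(r_g x) -(r_g y) gxy.
  rewrite -[x]e_spec -[y]e_spec -eq_r; apply: eq_iter_same_cycle s_t _.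
  by rewrite {2}eq_r.
have g_conj x : g (s x) = t (g x).
  rewrite -permM -expgSr /g (r_cycle _ _ (cycle_id s)).
  apply: eq_iter_same_cycle t_s _.
  by rewrite -{1}(r_cycle s x (cycle_id s)) e_spec expgSr permM e_spec.
apply/imsetP; exists (perm g_inj); rewrite ?inE // conjgE.
apply/permP => x; rewrite !permM -{1}[x](permKV (perm g_inj)) !(permE g_inj).
by rewrite g_conj.
Qed.

(** * Nicely separated subsets *)

Lemma generator_closed_class_support (T : finType) (S : {set {perm T}}) :
  generator_closed (class_support S [set: {perm T}])%g.
Proof.
move=> s t; rewrite class_supportEl => /bigcupP[x Sx sx] eq_st.
apply/bigcupP; exists x => //.
exact: class_trans (perm_same_cycle_conj eq_st) sx.
Qed.

Lemma generator_closedIgroup (gT : finGroupType) (K : {set gT})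
    (H : {group gT}) :
  generator_closed K -> generator_closed (K :&: H).
Proof.
move=> closedK x y /setIP[Kx Hx] eq_xy; rewrite inE (closedK x) //=.
by rewrite -cycle_subG -eq_xy cycle_subG.
Qed.

Lemma disjoint_Sym (T : finType) (A B : {set T}) :
  [disjoint A & B] -> Sym A :&: Sym B = 1%g.
Proof.
move=> dAB; apply/setP=> s; rewrite !inE; apply/andP/eqP => [[sA sB] | ->].
  apply/permP => x; rewrite perm1.
  have [xA | /(out_perm sA) //] := boolP (x \in A).
  by apply: (out_perm sB); rewrite (disjointFr dAB).
by rewrite !perm_on1.
Qed.

Theorem theorem3p4 (n : nat) (S : {set 'S_n}) (hS : nicely_separated S) :
  integral_graph (cayley S).
Proof.
have [l [T [l_ge2 [_ disjT] defS]]] := hS.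
set N := class_support S [set: 'S_n].
pose P i := N :&: Sym (T i).
have dT i j : i != j -> [disjoint T i & T j].
  by move=> neq_ij; rewrite -setI_eq0 disjT.
have permsE A : perms_in A = Sym A.
  by apply/setP=> s; rewrite !inE; apply: eq_subset => x; rewrite !inE.
have defSN : S = N :\: \bigcup_i P i.
  rewrite {1}defS /N class_supportEl; apply/setP=> x.
  apply/bigcupP/setDP => [[s Ss /setIP[sx /setDP[_ tx]]] | [Nx tx]].
    split; first by apply/bigcupP; exists s.
    apply: contra tx => /bigcupP[i _ /setIP[_ ix]].
    by apply/bigcupP; exists i; rewrite ?permsE.
  have /bigcupP[s Ss sx] := Nx; exists s => //.
  rewrite inE sx inE in_setT andbT; apply: contra tx => /bigcupP[i _ ix].
  apply/bigcupP; exists i => //; apply/setIP; rewrite -permsE; split=> //.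
  by rewrite /N class_supportEl.
(* The class of the identity is trivial, so the identity could lie in [N] only
   as an element of [S]; but it belongs to every [Sym (T i)]. *)
have notN1 : 1%g \notin N.
  apply/negP => N1; have : 1%g \in S.
    move: N1; rewrite /N class_supportEl => /bigcupP[s Ss].
    by rewrite class_sym class1G => /set1P <-.
  rewrite defSN => /setDP[_ /bigcupP[]].
  by exists (Ordinal (ltnW l_ge2)); rewrite // inE N1 group1.
have dP i j : i != j -> [disjoint P i & P j].
  move=> neq_ij; rewrite -setI_eq0 setIACA setIid disjoint_Sym ?dT //.
  by rewrite setI_eq0 disjoint_sym disjoints1.
have sPN : \bigcup_i P i \subset N.
  by apply/bigcupsP => i _; exact: subsetIl.
have adjS : adjacency_mx (cayley S) = adjacency_mx (cayley N)
          - \sum_i adjacency_mx (cayley (P i)).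
  rewrite !adjacency_cayley [X in _ = X - _](big_setID (\bigcup_i P i)) /=.
  rewrite (setIidPr sPN).
  rewrite -defSN partition_disjoint_bigcup // addrC.
  by under [X in _ - X]eq_bigr do rewrite adjacency_cayley; rewrite addrK.
have nN : [set: 'S_n] \subset ('N(N))%g.
  exact: class_support_norm S [set: 'S_n]%G.
have genN : generator_closed N.
  exact: generator_closed_class_support.
suff: integral_spectrum (adjacency_mx (cayley S)) by [].
rewrite adjS; apply: integral_spectrum_sub_sum => [|i|i|i j].
- by apply: (@cayley_integral _ [set: 'S_n]%G) => //; apply: subsetT.
- apply: (@cayley_integral _ (Sym (T i))); first exact: subsetIr.
    by apply: normsI; [exact: subset_trans (subsetT _) nN | exact: normG].
  exact: generator_closedIgroup.
- by apply: comm_adjacency_cayley; apply: subset_trans (subsetT _) nN.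
have [-> // | neq_ij] := eqVneq i j.
apply/comm_adjacency_cayley/(subset_trans _ (cent_sub _)).
apply/centsP => s /setIP[_ sj] t /setIP[_ ti]; rewrite !inE in sj ti.
by apply: perm_onC sj ti _; rewrite disjoint_sym dT.
Qed.
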